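(* Let $I_1:=I\subset\mathbb{Z}^d$ be a frequency set of finite cardinality $T_1=|I_1|\ge 3$, and let $0<\delta<1$ and $c>1$ be fixed real numbers. Assume in addition that $N_{I_1}\le\frac{c(T_1-1)}{\ln T_1}$. Then, with probability at least $1-\delta$, the random construction (S) described in the context produces a reconstructing multiple rank-1 lattice $\Lambda(\boldsymbol z_1,M_1,\dots,\boldsymbol z_\ell,M_\ell)$ for $I$ whose number $M$ of sampling nodes satisfies $$M\le 1-\ell+\sum_{j=1}^{\ell}M_j\le\left(2\left(\frac{c}{c-1}\right)^2\left(2\ln T_1-\ln\delta\right)+6\right)cT_1 .$$
   Context: The expansion of a finite nonempty set $I\subset\mathbb{Z}^d$ is $N_I:=\max_{j=1,\dots,d}\{\max_{\boldsymbol k\in I}k_j-\min_{\boldsymbol l\in I}l_j\}$. For a finite set $J\subset\mathbb{Z}^d$, $J_{\bmod M}:=\{\boldsymbol k\bmod M:\boldsymbol k\in J\}$ (componentwise residues in $\{0,\dots,M-1\}$), and $P^J:=\{M\in\mathbb{N}: M\text{ prime and }|J_{\bmod M}|=|J|\}$. For $\boldsymbol z\in\mathbb{Z}^d$, $M\in\mathbb{N}$, $\Lambda(\boldsymbol z,M)=\{\frac{j}{M}\boldsymbol z\bmod\boldsymbol 1: j=0,\dots,M-1\}\subset[0,1)^d$, and $\Lambda(\boldsymbol z_1,M_1,\dots,\boldsymbol z_\ell,M_\ell)=\bigcup_{j=1}^\ell\Lambda(\boldsymbol z_j,M_j)$ is a multiple rank-1 lattice, whose elements are its sampling nodes. It is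 called reconstructing for $I$ if the matrix $(e^{2\pi i\boldsymbol k\cdot\boldsymbol x})$ with rows indexed by its nodes $\boldsymbol x$ and columns indexed by $\boldsymbol k\in I$ has full column rank. Construction (S) (input $I$, $c$, $\delta$): put $T_1=|I|$, $J=I$, $\ell=0$. While $J\neq\emptyset$: let $T=|J|$, $s=\left\lceil\left(\frac{c}{c-1}\right)^2\frac{\ln T+\ln T_1-\ln\delta}{2}\right\rceil$, $\lambda=c(T-1)$, and let $M'$ be the smallest element of $P^{J}$ larger than $\lambda$; draw $\boldsymbol v_1,\dots,\boldsymbol v_s$ independently and uniformly at random from $[0,M'-1]^d\cap\mathbb{Z}^d$ (independently of earlier draws), and for each $i$ let $J(\boldsymbol v_i)=\{\boldsymbol k\in J:\ \boldsymbol k\cdot\boldsymbol v_i\not\equiv\boldsymbol h\cdot\boldsymbol v_i\ (\mathrm{mod}\ M')\text{ for all }\boldsymbol h\in J\setminus\{\boldsymbol k\}\}$; if $\max_i|J(\boldsymbol v_i)|\ge1$, choose $i_0$ attaining this maximum, increase $\ell$ by one, set $M_\ell=M'$, $\boldsymbol z_\ell=\boldsymbol v_{i_0}$ and replace $J$ by $J\setminus J(\boldsymbol v_{i_0})$; otherwise discard the draws and repeat. The output is $\Lambda(\boldsymbol z_1,M_1,\dots,\boldsymbol z_\ell,M_\ell)$. *)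

(* Defs.v *)
From HB Require Import structures.
From mathcomp Require Import all_boot all_order all_algebra finmap.
From mathcomp Require Import complex.
From mathcomp Require Import all_classical all_reals all_analysis.

Set Implicit Arguments.
Unset Strict Implicit.
Unset Printing Implicit Defensive.

Import Order.TTheory GRing.Theory Num.Theory.

Local Open Scope fset_scope.
Local Open Scope ring_scope.

(* Points of Z^d are row vectors 'rV[int]_d and nodes are row vectors
   'rV[R]_d.  Finite sets are {fset _}, with cardinality #|` _|. *)

Definition coords d (I : {fset 'rV[int]_d}) (j : 'I_d) : seq int :=
  [seq k ord0 j | k : 'rV[int]_d <- enum_fset I].

Definition coord_max d (I : {fset 'rV[int]_d}) (j : 'I_d) : int :=
  \big[Num.max/head 0 (coords I j)]_(a <- coords I j) a.

Definition coord_min d (I : {fset 'rV[int]_d}) (j : 'I_d) : int :=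
  \big[Num.min/head 0 (coords I j)]_(a <- coords I j) a.

(* N_I.  For nonempty I the differences are nonnegative, so starting the
   maximum over the coordinates at 0 has no effect when 0 < d. *)
Definition expansion d (I : {fset 'rV[int]_d}) : int :=
  \big[Num.max/0]_(j < d) (coord_max I j - coord_min I j).

Definition dotz d (k v : 'rV[int]_d) : int := \sum_(i < d) k ord0 i * v ord0 i.

Definition modv d (M : nat) (k : 'rV[int]_d) : 'rV[int]_d :=
  \row_(i < d) (k ord0 i %% M%:Z)%Z.

Definition mod_fset d (J : {fset 'rV[int]_d}) (M : nat) : {fset 'rV[int]_d} :=
  [fset modv M k | k in J].

(* M \in P^J *)
Definition in_PJ d (J : {fset 'rV[int]_d}) (M : nat) : bool :=
  prime M && (#|` mod_fset J M| == #|` J|).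

Lemma ex_PJ_above (R : realType) d (J : {fset 'rV[int]_d}) (x : R) :
  exists M : nat, in_PJ J M && (x < M%:R).
Proof.
pose B := (\sum_(k <- enum_fset J) \sum_(i < d) `|k 0%R i|)%N.
have leB (k : 'rV[int]_d) i : k \in J -> (`|k 0%R i| <= B)%N.
  move=> kJ; rewrite /B (big_rem k) //=.
  by apply: leq_trans (leq_addr _ _); rewrite (bigD1 i) //= leq_addr.
have [M ltM pM] := prime_above (B + B + Num.bound x).
exists M; rewrite /in_PJ pM /=; apply/andP; split; last first.
  apply: le_lt_trans (ler_norm x) _.
  apply: lt_le_trans (archi_boundP (normr_ge0 x)) _.
  rewrite ler_nat.
  have -> : Num.bound `|x| = Num.bound x by rewrite /Num.bound normr_id.
  by apply: leq_trans (ltnW ltM); rewrite leq_addl.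
apply/eqP; apply: card_in_imfset => k l kJ lJ /rowP eqkl.
apply/rowP => i; move: (eqkl i); rewrite !mxE => /eqP.
rewrite eqz_mod_dvd dvdzE absz_nat => dvdkl.
apply/eqP; rewrite -subr_eq0 -absz_eq0.
apply: contraTT dvdkl; rewrite -lt0n => gt0; rewrite gtnNdvd //.
apply: leq_ltn_trans ltM; apply: leq_trans (leq_addr _ _).
rewrite -lez_nat abszE; apply: le_trans (ler_normB _ _) _.
by rewrite -!abszE -PoszD lez_nat leq_add // leB.
Qed.

(* the smallest element of P^J larger than x *)
Definition next_PJ (R : realType) d (J : {fset 'rV[int]_d}) (x : R) : nat :=
  ex_minn (ex_PJ_above J x).

(* J(v), for the modulus M *)
Definition unaliased d (J : {fset 'rV[int]_d}) (M : nat) (v : 'rV[int]_d) :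
    {fset 'rV[int]_d} :=
  [fset k in J | all (fun h => dotz k v != dotz h v %[mod M%:Z])%Z
                     (enum_fset (J `\ k))].

Section Lattices.
Context {R : realType}.

(* the node (j/M) z mod 1 *)
Definition node d (z : 'rV[int]_d) (M j : nat) : 'rV[R]_d :=
  \row_(i < d) (j%:R / M%:R * (z 0 i)%:~R
                - (Num.floor (j%:R / M%:R * (z 0 i)%:~R : R))%:~R).

Definition rank1_lattice d (z : 'rV[int]_d) (M : nat) : {fset 'rV[R]_d} :=
  [fset x in [seq node z M j | j <- iota 0 M]].

Definition mrank1_lattice d (zM : seq ('rV[int]_d * nat)) : {fset 'rV[R]_d} :=
  \bigcup_(p <- zM) rank1_lattice p.1 p.2.

Definition fourier_char d (k : 'rV[int]_d) (x : 'rV[R]_d) : R[i] :=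
  let t := 2 * pi * \sum_(i < d) (k 0 i)%:~R * x 0 i in Complex (cos t) (sin t).

Definition fourier_matrix d (I : {fset 'rV[int]_d}) (X : {fset 'rV[R]_d}) :
    'M[R[i]]_(#|` X|, #|` I|) :=
  \matrix_(a < #|` X|, b < #|` I|)
     fourier_char (nth 0 (enum_fset I) b) (nth 0 (enum_fset X) a).

Definition reconstructing d (I : {fset 'rV[int]_d}) (X : {fset 'rV[R]_d}) : Prop :=
  \rank (fourier_matrix I X) = #|` I|.

End Lattices.

(* One pass through the loop of (S) is recorded as the sequence of vectors
   drawn in it, together with the (0-based) index i_0 chosen in it. *)
Definition pass d := (seq 'rV[int]_d * nat)%type.

Section Construction.
Context {R : realType} (d : nat) (I : {fset 'rV[int]_d}) (c delta : R).

(* The ceiling is positive when 0 < delta < 1, 1 < c and I, J are nonempty. *)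
Definition num_draws (J : {fset 'rV[int]_d}) : nat :=
  `|Num.ceil ((c / (c - 1)) ^+ 2
      * ((ln #|` J|%:R + ln #|` I|%:R - ln delta) / 2))|%N.

Definition modulus (J : {fset 'rV[int]_d}) : nat :=
  next_PJ J (c * (#|` J|%:R - 1)).

(* A state is the current J with the list of the (z_j, M_j) found so far.
   Passes after J has become empty are ignored. *)
Definition step (st : {fset 'rV[int]_d} * seq ('rV[int]_d * nat)) (p : pass d) :
    {fset 'rV[int]_d} * seq ('rV[int]_d * nat) :=
  let: (J, out) := st in
  let: (vs, i0) := p in
  if J == fset0 then st else
  let M := modulus J in
  if (0 < \max_(v <- vs) #|` unaliased J M v|)%N then
    (J `\` unaliased J M (nth 0 vs i0), rcons out (nth 0 vs i0, M))
  else st.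

Definition state (h : seq (pass d)) : {fset 'rV[int]_d} * seq ('rV[int]_d * nat) :=
  foldl step (I, [::]) h.

Definition remaining h := (state h).1.
Definition output h := (state h).2.

Definition in_box (M : nat) (v : 'rV[int]_d) : bool :=
  [forall i : 'I_d, (0 <= v 0 i) && (v 0 i < M%:Z)].

(* uniform probability mass function on [0, M-1]^d *)
Definition unif_box (M : nat) (v : 'rV[int]_d) : R :=
  if in_box M v then ((M ^ d)%N%:R)^-1 else 0.

Definition past (T : Type) (draws : nat -> T -> seq 'rV[int]_d)
    (pick : nat -> T -> nat) (n : nat) (w : T) : seq (pass d) :=
  [seq (draws m w, pick m w) | m <- iota 0 n].

(* The processes [draws] and [pick] realize the construction (S) on the
   probability space (Omega, P).  The set J, and with it the modulus and the
   number of draws, depends on the earlier passes; so [draws_law] says that,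
   given any past leading to a nonempty J, the vectors drawn next are
   independent and uniform on [0, M'-1]^d.  Ties in the choice of i_0 may be
   broken in any way, possibly at random. *)
Record construction_S (disp : measure_display) (Omega : measurableType disp)
    (P : probability Omega R) (draws : nat -> Omega -> seq 'rV[int]_d)
    (pick : nat -> Omega -> nat) : Prop := {
  measurable_draws : forall n vs,
    measurable [set w | draws n w = vs]%classic;
  measurable_pick : forall n i,
    measurable [set w | pick n w = i]%classic;
  draws_range : forall n w (J := remaining (past draws pick n w)),
    J != fset0 ->
    size (draws n w) = num_draws J /\ all (in_box (modulus J)) (draws n w);
  pick_max : forall n w (J := remaining (past draws pick n w)),
    J != fset0 ->
    (pick n w < size (draws n w))%N /\
    (forall v, v \in draws n w ->
      (#|` unaliased J (modulus J) v|
         <= #|` unaliased J (modulus J) (nth 0%R (draws n w) (pick n w))|)%N);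
  draws_law : forall n h vs (J := remaining h),
    J != fset0 -> size vs = num_draws J ->
    P [set w | past draws pick n w = h /\ draws n w = vs]%classic
    = (P [set w | past draws pick n w = h]%classic
       * (\prod_(v <- vs) unif_box (modulus J) v)%:E)%E
}.

End Construction.

(* Main.v *)
(** A pass of (S) that draws vectors [v_1, ..., v_s] for the current set [J]
    is called covering when every [k] in [J] lies in some [J(v_i)].  For a
    uniform [v] a given [k] lies outside [J(v)] with probability at most
    [(T - 1) / M' <= 1 / c], since each congruence [(k - h).v = 0 mod M'] cuts
    out a hyperplane of [F_M'^d].  As [ln c >= 2 (1 - 1/c)^2], the choice of
    [s] gives [c^-s <= delta / (T T_1)], and a pass fails to be covering with
    probability at most [delta / T_1].  A covering pass is never discarded, so
    outside an event of probability [delta] the first [T_1] passes exhaust [I].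

    A covering pass removes at least [T / s] of the [T] frequencies, and
    Bertrand's postulate gives [M' <= 2 (c T + N_I)].  Hence the potential
    [2 c s T + 2 N_I (s ln T + 1)], with [s] the number of draws in the first
    pass, decreases by at least [M'], which bounds the sum of the [M_j].

    The lattice found in a pass determines, by orthogonality of characters,
    the coefficients of the frequencies removed in that pass once those
    removed earlier are known; all lattices share the node [0]. *)

Require Import Defs.
From HB Require Import structures.
From mathcomp Require Import all_boot all_order all_algebra finmap.
From mathcomp Require Import complex.
From mathcomp Require Import all_classical all_reals all_analysis.
From mathcomp Require Import zify ring lra.

Set Implicit Arguments.
Unset Strict Implicit.
Unset Printing Implicit Defensive.

Import Order.TTheory GRing.Theory Num.Theory.
Import numFieldNormedType.Exports.

(** * Bertrand's postulate *)

Lemma prod_primes_dvd a b N :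
    (forall p, (a <= p < b)%N -> prime p -> (p %| N)%N) ->
  (\prod_(a <= p < b | prime p) p %| N)%N.
Proof.
elim: b => [|b IH] dvdN; first by rewrite big_geq ?dvd1n.
have [leab|ltba] := leqP a b; last by rewrite big_geq ?dvd1n.
rewrite big_mkcond big_nat_recr //= -big_mkcond /=.
have dvdp : (\prod_(a <= p < b | prime p) p %| N)%N.
  by apply: IH => p /andP[ap pb]; apply: dvdN; rewrite ap ltnW.
case: ifP => [pb|_]; last by rewrite muln1.
rewrite Gauss_dvd ?dvdp ?dvdN ?leab ?leqnn //.
rewrite big_seq_cond; elim/big_ind: _ => [|x y cx cy|p].
- exact: coprime1n.
- by rewrite coprimeMl cx.
- rewrite mem_index_iota => /andP[/andP[_ ltpb] pp].
  rewrite prime_coprime // dvdn_prime2 //; lia.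
Qed.

Lemma prime_ndvd_fact p n : prime p -> (n < p)%N -> ~~ (p %| n`!)%N.
Proof.
move=> pp; elim: n => [|n IH] ltnp; first by rewrite fact0 gtnNdvd ?prime_gt1.
rewrite factS (Euclid_dvdM _ _ pp) negb_or IH; last exact: ltnW.
by rewrite andbT gtnNdvd.
Qed.

(** The two middle coefficients of the row [2m + 1] are equal, and together they are at most the row
    sum [2 * 4 ^ m]. *)
Lemma bin_odd_le m : ('C(m.*2.+1, m) <= 4 ^ m)%N.
Proof.
have /(congr1 (subn^~ 0)) := expnDn 1 1 m.*2.+1.
rewrite !subn0 addn1 => eqs.
suff le2 : ('C(m.*2.+1, m) + 'C(m.*2.+1, m.+1) <= 2 ^ m.*2.+1)%N.
  move: le2; have <- : 'C(m.*2.+1, m) = 'C(m.*2.+1, m.+1).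
    by rewrite -bin_sub; [congr 'C(_, _)|]; lia.
  have -> : (2 ^ m.*2.+1 = 2 * 4 ^ m)%N by rewrite expnS -mul2n expnM.
  by move=> le2; lia.
have lt1 : (m < m.*2.+2)%N by lia.
have lt2 : (m.+1 < m.*2.+2)%N by lia.
rewrite eqs (bigD1 (Ordinal lt1)) //= (bigD1 (Ordinal lt2)) /=; last first.
  by rewrite -val_eqE /=; lia.
by rewrite !exp1n !muln1 addnA leq_addr.
Qed.

(** Strong induction. An even [n > 2] contributes no factor. For [n = 2k + 1] the primes up to
    [k + 1] fall under the induction hypothesis, and those above divide ['C(2k + 1, k) <= 4 ^ k],
    because they divide [(2k + 1)!] but neither [k!] nor [(k + 1)!]. *)
Lemma primorial_le n : (\prod_(0 <= p < n.+1 | prime p) p <= 4 ^ n)%N.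
Proof.
have [m] := ubnP n; elim: m n => // m IH n ltnm.
have [le2|gt2] := leqP n 2.
  by move: n le2 {ltnm} => [|[|[]]] //= _; rewrite unlock.
have [en|on] := boolP (~~ odd n).
  rewrite big_mkcond big_nat_recr //= -big_mkcond /= ifN ?muln1.
    case: n ltnm gt2 {en} => // n ltnm gt2.
    by apply: leq_trans (IH n _) _; rewrite ?leq_pexp2l //; lia.
  by apply: contra en => pn; case: (even_prime pn); lia.
have [k eqn] : exists k, n = k.*2.+1.
  by exists n./2; have := odd_double_half n; rewrite (negbNE on); lia.
rewrite (@big_cat_nat _ _ _ k.+2) /=; [|lia..].
have -> : (4 ^ n = 4 ^ k.+1 * 4 ^ k)%N by rewrite -expnD; congr expn; lia.
apply: leq_mul; first by apply: IH; lia.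
apply: leq_trans (bin_odd_le k).
apply: dvdn_leq; first by rewrite bin_gt0; lia.
apply: prod_primes_dvd => p ltp pp.
have : (p %| 'C(k.*2.+1, k) * (k`! * (k.*2.+1 - k)`!))%N.
  by rewrite bin_fact ?dvdn_fact //; lia.
rewrite !Euclid_dvdM // => /or3P[//|dvd|dvd].
- by move: dvd; apply: contraLR => _; apply: prime_ndvd_fact => //; lia.
- by move: dvd; apply: contraLR => _; apply: prime_ndvd_fact => //; lia.
Qed.

(** Passing from [n] to [n + 1] multiplies [2n * 'C(2n, n)] by [2 (2n + 1) / n], which exceeds 4. *)
Lemma central_bin_ge n : (0 < n)%N -> (4 ^ n <= n.*2 * 'C(n.*2, n))%N.
Proof.
case: n => // n _; elim: n => [//|n IH].
set N := n.+1 in IH *.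
have e1 := mul_bin_diag N.*2.+1 N.
have e2 := mul_bin_diag N.*2.+2 N.
have e3 : 'C(N.*2.+1, N) = 'C(N.*2.+1, N.+1).
  by rewrite -bin_sub; [congr 'C(_, _)|]; lia.
rewrite /= in e1 e2.
by rewrite doubleS expnS; nia.
Qed.

Section CentralBinomialFactors.
Variables (n p : nat).
Hypotheses (n_gt0 : (0 < n)%N) (p_pr : prime p).

(** Legendre's formula for [(2n)!] and for [n!]; the sum for [n!] extends to [k <= 2n] because
    [p ^ k > n] once [k > n]. *)
Lemma logn_central_bin : logn p 'C(n.*2, n) =
  (\sum_(1 <= k < n.*2.+1) (n.*2 %/ p ^ k - (n %/ p ^ k).*2))%N.
Proof.
have le2 k : ((n %/ p ^ k).*2 <= n.*2 %/ p ^ k)%N.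
  rewrite leq_divRL ?expn_gt0 ?prime_gt0 //.
  by rewrite -!muln2 mulnAC leq_mul2r leq_divM orbT.
rewrite sumnB; last by move=> *; exact: le2.
rewrite -logn_fact // -(@bin_fact n.*2 n) ?lognM ?bin_gt0 ?fact_gt0 ?muln_gt0 ?fact_gt0 //;
  [|lia..].
have -> : (n.*2 - n = n)%N by lia.
rewrite logn_fact //.
have -> : (\sum_(1 <= k < n.*2.+1) (n %/ p ^ k).*2 =
           (\sum_(1 <= k < n.+1) n %/ p ^ k).*2)%N.
  rewrite (@big_cat_nat _ _ _ n.+1) /=; [|lia..].
  rewrite [X in (_ + X)%N]big_nat_cond [X in (_ + X)%N]big1 ?addn0 => [|k /andP[/andP[ltnk _] _]].
    by rewrite -mul2n big_distrr /=; apply: eq_bigr => k _; rewrite mul2n.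
  by rewrite divn_small // (leq_trans ltnk) // ltnW // ltn_expl ?prime_gt1.
by rewrite addnn addnK.
Qed.

(** Each term of Legendre's sum is 0 or 1, and it vanishes as soon as [p ^ k > 2n]. *)
Lemma logn_central_bin_le : (logn p 'C(n.*2, n) <= trunc_log p n.*2)%N.
Proof.
set t := trunc_log p n.*2.
have p1 := prime_gt1 p_pr.
have ltt : (t < n.*2.+1)%N.
  by apply: leq_trans (ltn_expl t p1) _; apply/ltnW; rewrite ltnS trunc_logP //; lia.
rewrite logn_central_bin (@big_cat_nat _ _ _ t.+1) //=.
rewrite [X in (_ + X)%N]big_nat_cond [X in (_ + X)%N]big1 ?addn0 => [|k /andP[/andP[ltk _] _]].
  apply: (@leq_trans (\sum_(1 <= k < t.+1) 1)%N); last by rewrite sum_nat_const_nat; lia.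
  apply: leq_sum => k _; set q := (p ^ k)%N.
  have q0 : (0 < q)%N by rewrite expn_gt0 prime_gt0.
  have := divn_eq n q; have := ltn_pmod n q0; have := divn_eq n.*2 q.
  have := ltn_pmod n.*2 q0; nia.
rewrite divn_small //; apply: leq_trans (trunc_log_ltn _ p1) _.
by rewrite leq_pexp2l //; lia.
Qed.

Lemma pfactor_central_bin_le : (p ^ logn p 'C(n.*2, n) <= n.*2)%N.
Proof.
apply: (@leq_trans (p ^ trunc_log p n.*2)).
  by rewrite leq_pexp2l ?prime_gt0 // logn_central_bin_le.
by rewrite trunc_logP ?prime_gt1 //; lia.
Qed.

Lemma logn_central_bin_le1 : (n.*2 < p ^ 2)%N -> (logn p 'C(n.*2, n) <= 1)%N.
Proof.
move=> ltnp; apply: leq_trans logn_central_bin_le _.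
rewrite -ltnS -(ltn_exp2l _ _ (prime_gt1 p_pr)).
by apply: leq_ltn_trans ltnp; rewrite trunc_logP ?prime_gt1 //; lia.
Qed.

(** For such [p] the first term of Legendre's sum is [2 - 2 * 1 = 0]. The later ones vanish because
    [p >= 3] gives [p ^ 2 >= 3 p > 2n]. *)
Lemma logn_central_bin0 : (2 < p <= n)%N -> (n.*2 < 3 * p)%N ->
  logn p 'C(n.*2, n) = 0%N.
Proof.
move=> /andP[p2 pn] n3; rewrite logn_central_bin big_nat_cond big1 // => k.
move=> /andP[/andP[k1 _] _]; case: k k1 => // -[_|k _].
  rewrite expn1.
  have -> : (n.*2 %/ p = 2)%N by apply/eqP; rewrite eqn_leq leq_divRL ?prime_gt0 // -ltnS ltn_divLR ?prime_gt0 //; lia.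
  have -> : (n %/ p = 1)%N by apply/eqP; rewrite eqn_leq leq_divRL ?prime_gt0 // -ltnS ltn_divLR ?prime_gt0 //; lia.
  by [].
rewrite divn_small // (@leq_trans (p ^ 2)%N) ?leq_pexp2l ?prime_gt0 //.
by rewrite expnS expn1; nia.
Qed.

End CentralBinomialFactors.

Lemma sixth_power_le r : (30 <= r)%N -> (r.+1 ^ 6 <= 2 ^ r)%N.
Proof.
elim: r => // r IH; rewrite ltnS leq_eqVlt => /orP[/eqP<-|ltr].
  by rewrite (@expnM 2 5 6) leq_exp2r.
have := IH ltr; rewrite [(2 ^ r.+1)%N]expnS => le2.
suff : (r.+2 ^ 6 <= 2 * r.+1 ^ 6)%N by lia.
(* The cube grows by a factor of at most 7/5, and [(7/5)^2 < 2]. *)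
have le3 : (r.+2 ^ 3 * 10 <= r.+1 ^ 3 * 14)%N.
  have [y ->] : exists y, r = (y + 29)%N by exists (r - 29)%N; lia.
  by rewrite !expnS !expn0; nia.
have e6 x : (x ^ 6 = x ^ 3 * x ^ 3)%N by rewrite -expnD.
have := leq_mul le3 le3; rewrite !e6.
by move: (r.+2 ^ 3)%N (r.+1 ^ 3)%N => x y; nia.
Qed.

(* Erdos's proof: if there is no prime in (n, 2n], every prime factor of
   C(2n, n) is at most q = 2n/3, and those above r = sqrt (2n) occur once, so
   4^n / 2n <= C(2n, n) <= (2n)^(r - 1) 4^q.  This fails as soon as
   (r + 1)^6 <= 2^r. *)
Theorem bertrand n : (0 < n)%N -> exists p, prime p && (n < p <= n.*2)%N.
Proof.
move=> n0.
have [ltn|gen] := ltnP n 630.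
  (* Small [n]: each prime in this chain is less than twice its predecessor. *)
  have /= [p pin lt2] : exists2 p,
      p \in [:: 2; 3; 5; 7; 13; 23; 43; 83; 163; 317; 631]%N & (n < p <= n.*2)%N.
    have [?|?] := ltnP n 2; first by exists 2%N => //; lia.
    have [?|?] := ltnP n 3; first by exists 3%N => //; lia.
    have [?|?] := ltnP n 5; first by exists 5%N => //; lia.
    have [?|?] := ltnP n 7; first by exists 7%N => //; lia.
    have [?|?] := ltnP n 13; first by exists 13%N => //; lia.
    have [?|?] := ltnP n 23; first by exists 23%N => //; lia.
    have [?|?] := ltnP n 43; first by exists 43%N => //; lia.
    have [?|?] := ltnP n 83; first by exists 83%N => //; lia.
    have [?|?] := ltnP n 163; first by exists 163%N => //; lia.
    have [?|?] := ltnP n 317; first by exists 317%N => //; lia.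
    by exists 631%N => //; lia.
  have : all prime [:: 2; 3; 5; 7; 13; 23; 43; 83; 163; 317; 631]%N by vm_compute.
  by move=> /allP/(_ _ pin) pp; exists p; rewrite pp lt2.
have [//|noprime] := pselect (exists p, prime p && (n < p <= n.*2)%N).
exfalso.
have {}noprime p : prime p -> (n < p)%N -> (n.*2 < p)%N.
  move=> pp ltp; rewrite ltnNge; apply/negP => le2.
  by apply: noprime; exists p; rewrite pp ltp.
have [C defC] : exists C, C = 'C(n.*2, n) by eexists.
have C0 : (0 < C)%N by rewrite defC bin_gt0; lia.
have [r [r1 r2]] : exists r, (r ^ 2 <= n.*2 < r.+1 ^ 2)%N /\ (30 <= r)%N.
  have ex : exists r, (r ^ 2 <= n.*2)%N by exists 0%N.
  have ub r : (r ^ 2 <= n.*2)%N -> (r <= n.*2)%N by rewrite expnS expn1; nia.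
  case: (ex_maxnP ex ub) => r ler maxr; exists r; split.
    by rewrite ler ltnNge; apply/negP => /maxr; lia.
  by apply: maxr; rewrite expnS expn1; lia.
set q := (n.*2 %/ 3)%N.
have q3 : (q * 3 <= n.*2 < q.+1 * 3)%N.
  by have := divn_eq n.*2 3; have := @ltn_pmod n.*2 3 isT; rewrite -/q; lia.
have rq : (r < q)%N by move: r1; rewrite !expnS !expn0; nia.
have Fbig p : (q < p)%N -> logn p C = 0%N.
  move=> ltqp; have [pp|npp] := boolP (prime p); last by rewrite lognE (negPf npp).
  have [ltnp|lepn] := ltnP n p; last by rewrite defC; apply: logn_central_bin0 => //; lia.
  have := pfactor_central_bin_le n0 pp; rewrite -defC; have := noprime p pp ltnp.
  by case: (logn p C) => // k; rewrite expnS; have := expn_gt0 p k; nia.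
have leC : (C <= n.*2 ^ r.-1 * 4 ^ q)%N.
  (* The range is widened by [q] so that it can be cut at [q + 1]; the added factors equal 1. *)
  have eqC : C = (\prod_(0 <= p < (C + q).+1) p ^ logn p C)%N.
    by rewrite -[LHS](partnT C0) (widen_partn _ (leq_addr q C)); apply: eq_bigl.
  rewrite {1}eqC (@big_cat_nat _ _ _ q.+1) /=; [|lia..].
  rewrite [X in (_ * X <= _)%N]big_nat_cond [X in (_ * X <= _)%N]big1 ?muln1; last first.
    by move=> p /andP[/andP[ltq _] _]; rewrite Fbig.
  rewrite (@big_cat_nat _ _ _ r.+1) /=; [|lia..].
  apply: leq_mul.
    rewrite (@big_cat_nat _ _ _ 2) /=; [|lia..].
    have -> : (\prod_(0 <= p < 2) p ^ logn p C = 1)%N.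
      by rewrite big_ltn // big_nat1 (lognE 0) (lognE 1).
    rewrite mul1n.
    have -> : (r.-1 = r.+1 - 2)%N by lia.
    rewrite -prod_nat_const_nat; apply: leq_prod => p _.
    have [pp|npp] := boolP (prime p); first by rewrite defC; exact: pfactor_central_bin_le.
    by rewrite lognE (negPf npp) /=; lia.
  apply: leq_trans (primorial_le q).
  rewrite [X in (_ <= X)%N](@big_cat_nat _ _ _ r.+1) /=; [|lia..].
  apply: (@leq_trans (\prod_(r.+1 <= p < q.+1 | prime p) p)%N); last first.
    by rewrite leq_pmull //; apply: prodn_cond_gt0 => p; exact: prime_gt0.
  rewrite [X in (_ <= X)%N]big_mkcond [X in (X <= _)%N]big_nat_cond.
  rewrite [X in (_ <= X)%N]big_nat_cond.
  apply: leq_prod => p /andP[/andP[ltrp _] _]; case: ifP => [pp|npp].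
    rewrite -[X in (_ <= X)%N]expn1 leq_pexp2l ?prime_gt0 //.
    rewrite defC; apply: logn_central_bin_le1 => //; case/andP: r1 => _ r1.
    by apply: leq_trans r1 _; rewrite leq_exp2r.
  by rewrite lognE npp.
have le4 : (4 ^ n <= n.*2 ^ r * 4 ^ q)%N.
  apply: leq_trans (central_bin_ge n0) _; rewrite -defC.
  by have -> : (r = r.-1.+1)%N by [lia]; rewrite expnS -mulnA leq_mul2l leC orbT.
(* Cubing turns [4 ^ q] into [4 ^ (3q) <= 4 ^ (2n)], which cancels against [4 ^ (3n)]. *)
have le5 : (4 ^ n <= n.*2 ^ (r * 3))%N.
  move: le4; rewrite -(@leq_exp2r _ _ 3) // expnMn -!expnM => le4.
  have /(leq_trans le4) : (n.*2 ^ (r * 3) * 4 ^ (q * 3) <= n.*2 ^ (r * 3) * 4 ^ n.*2)%N.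
    by rewrite leq_mul2l leq_exp2l //; lia.
  by have -> : (n * 3 = n + n.*2)%N by [lia]; rewrite expnD leq_pmul2r ?expn_gt0.
(* The contradiction: [2^(r^2) <= 4^n <= (2n)^(3r) < ((r+1)^6)^r <= (2^r)^r]. *)
have : (2 ^ (r ^ 2) < (2 ^ r) ^ r)%N; last by rewrite -expnM expnS expn1 ltnn.
apply: (@leq_ltn_trans (4 ^ n)); first by rewrite -(expnM 2 2) leq_exp2l //; lia.
apply: leq_ltn_trans le5 _; rewrite mulnC expnM ltn_exp2r; last by lia.
apply: leq_trans (sixth_power_le r2).
by rewrite (expnM _ 2 3) ltn_exp2r //; lia.
Qed.

Local Open Scope fset_scope.
Local Open Scope ring_scope.

(** * The moduli and the aliasing hyperplanes *)

Lemma le_bigmax_mem disp (T : orderType disp) (x0 : T) (s : seq T) a :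
  a \in s -> (a <= \big[Order.max/x0]_(b <- s) b)%O.
Proof.
elim: s => // b s IH; rewrite inE big_cons le_max => /orP[/eqP->|/IH->].
  by rewrite lexx.
by rewrite orbT.
Qed.

Lemma ge_bigmin_mem disp (T : orderType disp) (x0 : T) (s : seq T) a :
  a \in s -> (\big[Order.min/x0]_(b <- s) b <= a)%O.
Proof.
elim: s => // b s IH; rewrite inE big_cons ge_min => /orP[/eqP->|/IH->].
  by rewrite lexx.
by rewrite orbT.
Qed.

Lemma expansion_ge0 d (I : {fset 'rV[int]_d}) : 0 <= expansion I.
Proof.
by rewrite /expansion; elim/big_rec: _ => // i x _ x0; rewrite le_max x0 orbT.
Qed.

Lemma coord_sub_le d (I : {fset 'rV[int]_d}) k h i : k \in I -> h \in I ->
  k 0 i - h 0 i <= expansion I.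
Proof.
move=> kI hI; have mem l : l \in I -> l 0 i \in coords I i.
  by move=> lI; apply/mapP; exists l.
apply: (@le_trans _ _ (coord_max I i - coord_min I i)).
  by apply: lerB; [exact/le_bigmax_mem/mem|exact/ge_bigmin_mem/mem].
rewrite /expansion (bigD1 i) //=.
by rewrite le_max lexx.
Qed.

(** Coordinates of two points of [I] differ by at most the expansion, so a congruence modulo a
    larger [M] forces equality. *)
Lemma in_PJ_gt_expansion d (I J : {fset 'rV[int]_d}) M :
  J `<=` I -> prime M -> expansion I < M%:Z -> in_PJ J M.
Proof.
move=> /fsubsetP JI pM ltM; rewrite /in_PJ pM /=.
apply/card_in_imfsetP => k h kJ hJ /rowP eqkh.
apply/rowP => i; move: (eqkh i); rewrite !mxE => /eqP.
rewrite eqz_mod_dvd dvdzE absz_nat => dvdkl.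
apply/eqP; rewrite -subr_eq0 -absz_eq0.
apply: contraTT dvdkl; rewrite -lt0n => gt0; rewrite gtnNdvd //.
have := coord_sub_le i (JI _ kJ) (JI _ hJ); have := coord_sub_le i (JI _ hJ) (JI _ kJ).
by move: (expansion I) ltM (k 0 i) (h 0 i) gt0 => N; lia.
Qed.

Lemma modulusP (R : realType) d (c : R) (J : {fset 'rV[int]_d}) :
  in_PJ J (modulus c J) /\ c * (#|` J|%:R - 1) < (modulus c J)%:R.
Proof. by rewrite /modulus /next_PJ; case: ex_minnP => M /andP[]. Qed.

Lemma modulus_prime (R : realType) d (c : R) (J : {fset 'rV[int]_d}) :
  prime (modulus c J).
Proof. by have [/andP[]] := modulusP c J. Qed.

Lemma modulus_le (R : realType) d (c : R) (I J : {fset 'rV[int]_d}) :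
  1 < c -> J `<=` I -> J != fset0 ->
  (modulus c J)%:R <= 2 * (c * #|` J|%:R + (expansion I)%:~R).
Proof.
move=> c1 JI J0.
have T1 : 1 <= #|` J|%:R :> R by rewrite ler1n cardfs_gt0.
have /gez0_abs eqN := expansion_ge0 I; set N := `|expansion I|%N in eqN.
(* A prime above this [n] exceeds both [c (T - 1)] and the expansion, hence is a candidate for the
   modulus. The entry 1 makes [n] positive for Bertrand's postulate. *)
pose n := maxn (Num.truncn (c * (#|` J|%:R - 1))) (maxn N 1).
have x0 : 0 <= c * (#|` J|%:R - 1) by rewrite mulr_ge0 //; lra.
have n0 : (0 < n)%N by rewrite /n; lia.
have [p /andP[pp /andP[ltp lep]]] := bertrand n0.
apply: (@le_trans _ _ (n.*2)%:R).
  rewrite ler_nat; apply: leq_trans lep.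
  rewrite /modulus /next_PJ; case: ex_minnP => M _; apply; apply/andP; split.
    by apply: (in_PJ_gt_expansion JI pp); rewrite -eqN; move: ltp; rewrite /n; lia.
  by rewrite -truncn_lt_nat //; move: ltp; rewrite /n; lia.
rewrite -mul2n natrM ler_pM2l // -eqN.
have N0 : 0 <= N%:R :> R by [].
have cT : 1 <= c * #|` J|%:R by rewrite -[1]mul1r ler_pM //; lra.
rewrite /n /maxn; case: ifP => _; last first.
  have /andP[+ _] := truncn_itv x0; rewrite mulrBr pmulrn => le1.
  by rewrite -!pmulrn in le1 *; lra.
by case: ifP => _; rewrite -pmulrn; lra.
Qed.

Section Counting.
Variables (p d : nat).
Hypothesis p_pr : prime p.

(** Parametrises the box [[0, p - 1]^d] by the vector space [F_p^d], so that congruences become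
    linear equations. *)
Definition int_row (u : 'rV['F_p]_d) : 'rV[int]_d := \row_j (nat_of_ord (u 0 j))%:Z.

Definition dot_Fp (a : 'rV[int]_d) (u : 'rV['F_p]_d) : 'F_p :=
  \sum_j (a 0 j)%:~R * u 0 j.

Lemma dvd_dotz (a : 'rV[int]_d) u : (p %| dotz a (int_row u))%Z = (dot_Fp a u == 0).
Proof.
rewrite (dvdz_pcharf (pchar_Fp p_pr)) /dotz rmorph_sum /=; congr (_ == _).
apply: eq_bigr => j _; rewrite rmorphM /= mxE; congr (_ * _).
by rewrite -[RHS](natr_Zp (u 0 j)).
Qed.

(** The set is the kernel of the linear form [dot_Fp a]. Since [a i] is invertible, [w t] is a
    preimage of each [t], so the [p] fibres are translates of the kernel and partition [F_p^d]. *)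
Lemma card_dvd_dotz (a : 'rV[int]_d) (i : 'I_d) : ~~ (p %| a ord0 i)%Z ->
  (#|[set u | (p %| dotz a (int_row u))%Z]| * p = p ^ d)%N.
Proof.
rewrite (dvdz_pcharf (pchar_Fp p_pr)) => ai0.
have dotD u v : dot_Fp a (u + v) = dot_Fp a u + dot_Fp a v.
  by rewrite /dot_Fp -big_split; apply: eq_bigr => j _; rewrite mxE mulrDr.
pose w t : 'rV['F_p]_d := (t / (a 0 i)%:~R) *: delta_mx 0 i.
have dotw t : dot_Fp a (w t) = t.
  rewrite /dot_Fp (bigD1 i) //= big1 => [|j neji].
    by rewrite !mxE !eqxx mulr1 addr0 mulrC divfK.
  by rewrite !mxE (negPf neji) andbF !mulr0.
have <- : #|'rV['F_p]_d| = (p ^ d)%N by rewrite card_mx card_Fp // mul1n.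
rewrite -[RHS]sum1_card (partition_big (dot_Fp a) predT) //=.
rewrite (eq_bigr (fun=> #|[set u | (p %| dotz a (int_row u))%Z]|)).
  by rewrite sum_nat_const card_Fp // mulnC.
move=> t _; rewrite sum1_card.
rewrite -[RHS](card_imset _ (@addrI _ (w t))); apply: eq_card => u.
rewrite [LHS](_ : _ = (dot_Fp a u == t)) //; apply/eqP/imsetP => [<-|[v + ->]].
  exists (u - w (dot_Fp a u)); last by rewrite addrC subrK.
  rewrite inE dvd_dotz.
  have := dotD (u - w (dot_Fp a u)) (w (dot_Fp a u)); rewrite subrK dotw => e.
  by apply/eqP; apply: (addIr (dot_Fp a u)); rewrite -e add0r.
by rewrite inE dvd_dotz => /eqP e; rewrite dotD dotw e addr0.
Qed.

Lemma in_box_int_row v : in_box p v -> exists u : 'rV['F_p]_d, v = int_row u.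
Proof.
move=> /forallP box; exists (\row_j (`|v 0%R j|%N)%:R); apply/rowP => j.
have := box j => /andP[v0 vp]; rewrite !mxE val_Fp_nat // modn_small; last by lia.
by rewrite gez0_abs.
Qed.

Lemma int_row_in_box u : in_box p (int_row u).
Proof.
apply/forallP => j; rewrite mxE; have := ltn_ord (u 0 j).
by move: (u 0 j) => x; rewrite {2}Fp_cast //; lia.
Qed.

End Counting.

(** Union bound over the hyperplanes [(k - h).u = 0] for [h] in [J] other than [k]. They are proper
    because [M] in P^J keeps [k - h] from vanishing modulo [M]. *)
Lemma aliased_card_le d (J : {fset 'rV[int]_d}) M k (pM : prime M) :
  in_PJ J M -> k \in J ->
  (#|[set u : 'rV['F_M]_d | k \notin unaliased J M (int_row u)]| * M
     <= (#|` J| - 1) * M ^ d)%N.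
Proof.
move=> /andP[_ /card_in_imfsetP injJ] kJ.
have -> : (#|` J| - 1 = size (enum_fset (J `\ k)))%N.
  by have := cardfsD1 k J; rewrite kJ; lia.
have allJ : {subset enum_fset (J `\ k) <= J `\ k} by [].
have -> : [set u : 'rV['F_M]_d | k \notin unaliased J M (int_row u)] =
   [set u | has (fun h => (M %| dotz (k - h) (int_row u))%Z) (enum_fset (J `\ k))].
  apply/setP => u; rewrite !inE kJ /= -has_predC; apply: eq_has => h /=.
  rewrite negbK eqz_mod_dvd; congr (_ %| _)%Z; rewrite /dotz -sumrB.
  by apply: eq_bigr => j _; rewrite !mxE mulrBl.
elim: (enum_fset _) allJ => [_|h s IH sJ].
  by rewrite mul0n; set A := [set u | _]; by have -> : A = finset.set0 by [apply/setP => u; rewrite !inE]; rewrite cards0.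
have hJ : h \in J `\ k by apply: sJ; rewrite inE eqxx.
rewrite /= mulSn.
apply: (@leq_trans (#|[set u : 'rV['F_M]_d | (M %| dotz (k - h) (int_row u))%Z]| * M +
  #|[set u : 'rV['F_M]_d | has (fun h => (M %| dotz (k - h) (int_row u))%Z) s]| * M)).
  rewrite -mulnDl leq_mul2r; apply/orP; right.
  have -> : forall P Q : pred 'rV['F_M]_d, [set u | P u || Q u] = [set u | P u] :|: [set u | Q u].
    by move=> P Q; apply/setP => u; rewrite !inE.
  exact: leq_card_setU.
apply: leq_add; last by apply: IH => x xs; apply: sJ; rewrite inE xs orbT.
have [i ndvd] : exists i, ~~ (M %| (k - h) ord0 i)%Z.
  apply/existsP; apply: contraT; rewrite negb_exists => /forallP alldvd.
  move: hJ; rewrite !inE => /andP[+ hJ]; rewrite eq_sym => /eqP[].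
  apply: injJ => //; apply/rowP => j; rewrite !mxE; apply/eqP.
  by rewrite eqz_mod_dvd; have := alldvd j; rewrite negbK !mxE.
by rewrite (card_dvd_dotz pM ndvd).
Qed.

(** * Sampling matrices of multiple rank-1 lattices *)

Section Fourier.
Variable R : realType.
Implicit Types t u : R.

(** The exponential [e^(i t)]; [fourier_char k x] is [cis] at [2 pi k.x]. *)
Definition cis t : R[i] := Complex (cos t) (sin t).

Lemma cisD t u : cis (t + u) = cis t * cis u.
Proof.
by apply/eqP; rewrite eq_complex /= cosD sinD eqxx addrC eqxx.
Qed.

Lemma cis0 : cis 0 = 1.
Proof. by rewrite /cis cos0 sin0. Qed.

Lemma cisMn t n : cis (t *+ n) = cis t ^+ n.
Proof. by elim: n => [|n IH]; rewrite ?mulr0n ?cis0 // mulrS cisD IH exprS. Qed.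

Lemma cis_2pi_int (n : int) : cis (2 * pi * n%:~R) = 1.
Proof.
have cis2pi : cis (2 * pi) = 1.
  by rewrite mulr_natl mulr2n /cis cosDpi sinDpi cospi sinpi !oppr0 opprK.
have nat_case m : cis (2 * pi * m%:R) = 1 by rewrite mulr_natr cisMn cis2pi expr1n.
case: n => m; first exact: nat_case.
rewrite NegzE mulrNz mulrN -pmulrn.
by have := cisD (- (2 * pi * m.+1%:R)) (2 * pi * m.+1%:R); rewrite addNr cis0 nat_case mulr1.
Qed.

Lemma cis_neq1 t : 0 < t < 2 * pi -> cis t != 1.
Proof.
move=> /andP[t0 t2]; rewrite eq_complex negb_and; apply/orP; left => /=.
have s0 : 0 < sin (t / 2) by apply: sin_gt0_pi; rewrite divr_gt0 //=; lra.
have -> : t = t / 2 + t / 2 by lra.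
rewrite cosD -!expr2 cos2sin2 lt_eqF //.
by have := exprn_gt0 2 s0; lra.
Qed.

(** A geometric sum in the root of unity [w = e^(2 pi i m / M)]: since [w ^+ M = 1], it vanishes
    unless [w = 1]. *)
Lemma sum_cis M (m : int) : (0 < M)%N ->
  \sum_(j < M) cis (2 * pi * (m%:~R * (j%:R / M%:R))) =
  if (M %| m)%Z then M%:R else 0.
Proof.
move=> M0; have MR : M%:R != 0 :> R by rewrite pnatr_eq0 -lt0n.
pose w := cis (2 * pi * (m%:~R / M%:R)).
have -> : \sum_(j < M) cis (2 * pi * (m%:~R * (j%:R / M%:R))) = \sum_(j < M) w ^+ j.
  apply: eq_bigr => j _; rewrite -cisMn; congr cis; rewrite -[_ *+ j]mulr_natr; lra.
have wM : w ^+ M = 1.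
  by rewrite -cisMn -[_ *+ M]mulr_natr -!mulrA mulVf // mulr1 mulrA cis_2pi_int.
(* Reducing [m] modulo [M] puts the angle into [[0, 2 pi)], where [cis_neq1] decides whether
   [w = 1]. *)
have wE : w = cis (2 * pi * ((m %% M)%Z%:~R / M%:R)).
  have -> : w = cis (2 * pi * ((m %/ M)%Z%:~R + (m %% M)%Z%:~R / M%:R)).
    congr (cis (_ * _)); apply: (mulIf MR); rewrite mulrDl !divfK //.
    by rewrite {1}(divz_eq m M) intrD intrM -pmulrn.
  by rewrite [_ * (_ + _)]mulrDr cisD cis_2pi_int mul1r.
case: ifPn => [/dvdz_mod0P r0|ndvd].
  rewrite wE r0 mul0r mulr0 cis0.
  by under eq_bigr do rewrite expr1n; rewrite sumr_const card_ord.
have w1 : w != 1.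
  have r_ge0 := modz_ge0 m (_ : M%:Z != 0); have r_lt := ltz_pmod m (_ : 0 < M%:Z).
  have r0 : (0 < (m %% M)%Z)%R.
    rewrite lt_neqAle r_ge0 ?andbT; last by rewrite -lt0n.
    by rewrite eq_sym; apply: contra ndvd => /eqP/dvdz_mod0P.
  have rM : (m %% M)%Z < M%:Z by apply: r_lt.
  rewrite wE; apply: cis_neq1.
  rewrite -(@ltr0z R) in r0; rewrite -(@ltr_int R) -pmulrn in rM.
  have MR0 : 0 < M%:R :> R by rewrite ltr0n.
  rewrite !mulr_gt0 ?pi_gt0 ?invr_gt0 //= -[ltRHS]mulr1 ltr_pM2l ?mulr_gt0 ?pi_gt0 //.
  by rewrite ltr_pdivrMr // mul1r.
by apply/eqP; have := subrX1 w M; rewrite wM subrr => /esym/eqP; rewrite mulf_eq0 subr_eq0 (negPf w1).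
Qed.

(** Reduction of the node modulo 1 changes [k.x] by an integer, which the exponential does not
    see. *)
Lemma fourier_char_node d (k z : 'rV[int]_d) M j :
  fourier_char k (node z M j : 'rV[R]_d) =
  cis (2 * pi * ((dotz k z)%:~R * (j%:R / M%:R))).
Proof.
rewrite /fourier_char; set x : R := j%:R / M%:R.
have -> : \sum_(i < d) (k 0 i)%:~R * (node z M j : 'rV[R]_d) 0 i =
   (dotz k z)%:~R * x + (- \sum_(i < d) k 0 i * Num.floor (x * (z 0 i)%:~R))%:~R.
  rewrite /dotz rmorphN !rmorph_sum /= mulr_suml -sumrB; apply: eq_bigr => i _.
  by rewrite mxE -/x !intrM mulrBr -mulrA [x * _]mulrC.
by rewrite mulrDr -/(cis _) cisD cis_2pi_int mulr1.
Qed.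

(** Multiplying the samples by the conjugate character of [k] and summing over the nodes isolates
    [M * g k]: every other [h] has [h.z] incongruent to [k.z], so its sum vanishes by
    orthogonality. *)
Lemma unaliased_coef0 d (J : {fset 'rV[int]_d}) M (z k : 'rV[int]_d)
    (g : 'rV[int]_d -> R[i]) : (0 < M)%N ->
  (forall j, (j < M)%N ->
     \sum_(h <- enum_fset J) g h * fourier_char h (node z M j) = 0) ->
  k \in unaliased J M z -> g k = 0.
Proof.
move=> M0 sum0; rewrite !inE => /andP[kJ /allP noalias].
have : \sum_(j < M) cis (- (2 * pi * ((dotz k z)%:~R * (j%:R / M%:R)))) *
  (\sum_(h <- enum_fset J) g h * fourier_char h (node z M j)) = 0.
  by apply: big1 => j _; rewrite sum0 ?mulr0.
under eq_bigr do rewrite mulr_sumr.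
rewrite exchange_big /= (big_rem k) //= [X in _ + X]big_seq [X in _ + X]big1 ?addr0 => [|h hJ].
  under eq_bigr => j _ do rewrite fourier_char_node mulrCA -cisD addNr cis0 mulr1.
  by rewrite sumr_const card_ord -mulr_natr => /eqP; rewrite mulf_eq0 pnatr_eq0 -[M == 0%N]negbK -lt0n M0 orbF => /eqP.
rewrite (eq_bigr (fun j : 'I_M => g h *
    cis (2 * pi * ((dotz h z - dotz k z)%:~R * (j%:R / M%:R))))) => [|j _].
  rewrite -mulr_sumr sum_cis // ifN ?mulr0 // -eqz_mod_dvd eq_sym.
  by apply: noalias; move: hJ; rewrite mem_rem_uniq ?fset_uniq // !inE.
by rewrite fourier_char_node mulrCA -cisD; congr (_ * cis _); rewrite intrB; lra.
Qed.

End Fourier.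

(** * Injectivity of the sampling matrix and the number of nodes *)

Section Reconstruction.
Variables (R : realType) (d : nat) (I : {fset 'rV[int]_d}) (c : R).
Implicit Type h : seq (pass d).

Lemma remaining_rcons h vs i0 (J := remaining I c h)
    (z := nth 0 vs i0) (M := modulus c J) :
  remaining I c (rcons h (vs, i0)) = J /\ output I c (rcons h (vs, i0)) = output I c h
  \/ remaining I c (rcons h (vs, i0)) = J `\` unaliased J M z /\
     output I c (rcons h (vs, i0)) = rcons (output I c h) (z, M).
Proof.
rewrite /remaining /output /state foldl_rcons -/(state I c h) /M /z /J /remaining.
case: (state I c h) => J' out /=; case: ifP => _; first by left.
by case: ifP => _; [right|left].
Qed.

Lemma remaining_sub h : remaining I c h `<=` I.
Proof.
elim/last_ind: h => [|h [vs i0] IH]; first exact: fsubset_refl.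
have [[-> _] //|[-> _]] := remaining_rcons h vs i0.
by apply: fsubset_trans IH; exact: fsubsetDl.
Qed.

Lemma output_modulus_gt0 h p : p \in output I c h -> (0 < p.2)%N.
Proof.
elim/last_ind: h p => [|h [vs i0] IH] p //.
have [[_ ->]|[_ ->]] := remaining_rcons h vs i0; first exact: IH.
rewrite mem_rcons inE => /orP[/eqP-> /=|]; last exact: IH.
by rewrite prime_gt0 // modulus_prime.
Qed.

Lemma mem_mrank1 (zM : seq ('rV[int]_d * nat)) p j : p \in zM -> (j < p.2)%N ->
  (node p.1 p.2 j : 'rV[R]_d) \in mrank1_lattice zM.
Proof.
move=> pzM ltj; apply/bigfcupP; exists p; first by rewrite pzM.
by rewrite inE; apply/mapP; exists j; rewrite ?mem_iota.
Qed.

Lemma coef0_of_samples0 h (g : 'rV[int]_d -> R[i]) :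
  (forall x, x \in (mrank1_lattice (output I c h) : {fset 'rV[R]_d}) ->
     \sum_(k <- enum_fset I) g k * fourier_char k x = 0) ->
  forall k, k \in I `\` remaining I c h -> g k = 0.
Proof.
elim/last_ind: h => [|h [vs i0] IH] sum0 k; first by rewrite fsetDv.
have [[e1 e2]|[e1 e2]] := remaining_rcons h vs i0; rewrite e2 in sum0; rewrite e1.
  exact: IH.
set J := remaining I c h in e1 e2 sum0 IH *.
set M := modulus c J in e1 e2 sum0 *; set z := nth 0 vs i0 in e1 e2 sum0 *.
have {}IH k' : k' \in I `\` J -> g k' = 0.
  apply: IH => x /bigfcupP[p /andP[pout _] xp]; apply: sum0.
  by apply/bigfcupP; exists p; rewrite // mem_rcons inE pout orbT.
rewrite inE => /andP[nk kI]; have [kJ|kJ] := boolP (k \in J); last first.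
  by apply: IH; rewrite !inE kJ.
have ku : k \in unaliased J M z by move: nk; rewrite inE kJ andbT negbK.
apply: (@unaliased_coef0 _ _ J M z) ku => [|j ltj].
  by rewrite prime_gt0 // modulus_prime.
(* Frequencies outside [J] already have coefficient 0, so the sample over [I] is a sample over [J]
   alone. *)
rewrite -[RHS](sum0 (node z M j)); last first.
  by apply: (@mem_mrank1 _ (z, M)); rewrite // mem_rcons mem_head.
rewrite [RHS](bigID (mem J)) /= [X in _ + X]big_seq_cond.
rewrite [X in _ + X]big1 ?addr0 => [|k' /andP[k'I nk']]; last first.
  by rewrite IH ?mul0r // !inE nk'.
rewrite -[RHS]big_filter; apply: perm_big; apply: uniq_perm => [||k'].
- exact: fset_uniq.
- by rewrite filter_uniq // fset_uniq.
- rewrite mem_filter /=; apply/idP/andP => [k'J|[]//]; split=> //.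
  exact: (fsubsetP (remaining_sub h)).
Qed.

Lemma reconstructing_output h : remaining I c h = fset0 ->
  reconstructing I (mrank1_lattice (output I c h) : {fset 'rV[R]_d}).
Proof.
move=> J0; rewrite /reconstructing -mxrank_tr; apply/eqP.
suff : row_free (fourier_matrix I (mrank1_lattice (output I c h) : {fset 'rV[R]_d}))^T by [].
apply: inj_row_free => v vA0.
(* Full column rank is injectivity; [g] reads a kernel vector as a coefficient function on Z^d, with
   value 0 off [I]. *)
pose g (k : 'rV[int]_d) : R[i] := oapp (v 0) 0 (insub (index k (enum_fset I))).
apply/rowP => b; rewrite mxE.
have <- : g (nth 0 (enum_fset I) b) = v 0 b.
  by rewrite /g index_uniq ?fset_uniq // valK.
apply: (@coef0_of_samples0 h); last by rewrite J0 fsetD0; apply: mem_nth.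
move=> x xX; have ltx : (index x (enum_fset (mrank1_lattice (output I c h) : {fset 'rV[R]_d})) < #|` mrank1_lattice (output I c h) : {fset 'rV[R]_d}|)%N.
  by rewrite index_mem.
have /rowP/(_ (Ordinal ltx)) := vA0; rewrite !mxE => vx0; rewrite -[RHS]vx0.
rewrite (big_nth 0) big_mkord; apply: eq_bigr => b' _.
rewrite !mxE /= nth_index //; congr (_ * _).
by rewrite /g index_uniq ?fset_uniq // valK.
Qed.

Lemma card_mrank1_lattice (zM : seq ('rV[int]_d * nat)) :
  (forall p, p \in zM -> (0 < p.2)%N) ->
  (#|` (mrank1_lattice zM : {fset 'rV[R]_d})| + size zM
     <= 1 + \sum_(p <- zM) p.2)%N.
Proof.
move=> M_gt0.
(* With the origin adjoined, the empty union has one point and each further lattice, also the first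
   one, meets what is already there. *)
suff le0 : (#|` 0%R |` (mrank1_lattice zM : {fset 'rV[R]_d})| + size zM
     <= 1 + \sum_(p <- zM) p.2)%N.
  by apply: leq_trans le0; rewrite leq_add2r fsubset_leq_card // fsubsetU1.
elim: zM M_gt0 => [_|p zM IH M_gt0].
  by rewrite big_nil addn0 /mrank1_lattice big_nil fsetU0 cardfs1.
have {}IH := IH (fun q qzM => M_gt0 q (mem_behead (s := p :: zM) qzM)).
rewrite big_cons /mrank1_lattice big_cons -/(mrank1_lattice zM) fsetUCA.
set B := 0%R |` _ in IH *; set A := rank1_lattice p.1 p.2.
have cA : (#|` A : {fset 'rV[R]_d}| <= p.2)%N.
  by rewrite card_fseq (leq_trans (size_undup _)) // size_map size_iota.
have : (0 < #|` A `&` B|)%N.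
  rewrite cardfs_gt0; apply/fset0Pn; exists 0; rewrite !inE eqxx andbT.
  apply/mapP; exists 0%N; first by rewrite mem_iota M_gt0 ?mem_head.
  by apply/rowP => i; rewrite !mxE !mul0r floor0 subrr.
have := cardfsUI A B; move: cA IH => /=.
move: #|` A `|` B| #|` A `&` B| #|` A| #|` B| (\sum_(j <- zM) j.2)%N.
by move=> u v a b s; lia.
Qed.

End Reconstruction.

(** * The number of draws *)

Section Analysis.
Variable R : realType.
Implicit Types (c x y delta : R).

(* The derivative of [ln y - 2 (1 - 1/y)^2] is [(y - 2)^2 / y^3]. *)
Lemma ln_ge_sqr c : 1 <= c -> 2 * (1 - c^-1) ^+ 2 <= ln c.
Proof.
move=> c1; pose f (y : R) := ln y - 2 * (1 - y^-1) ^+ 2.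
have D y : 0 < y -> is_derive y 1 f ((y - 2) ^+ 2 / y ^+ 3).
  move=> y0.
  have yn0 : y != 0 by rewrite gt_eqF.
  have dln := is_derive1_ln y0.
  have dinv : is_derive y 1 (fun z : R => z^-1) (- y ^- 2 *: 1).
    by apply: (@is_deriveV R id).
  have dcst (a : R) : is_derive y 1 (cst a : R -> R) 0 by exact: is_derive_cst.
  have d2 := is_deriveM (dcst 2) (is_deriveX 2 (is_deriveB (dcst 1) dinv)).
  apply: (is_derive_eq (is_deriveB dln d2)); rewrite /GRing.scale /=.
  have -> : (cst 1 - (fun z : R => z^-1)) y = 1 - y^-1 by [].
  by rewrite /cst; field.
have : f 1 <= f c.
  have := @ger0_derive1_ndecr R f 1 c.
  apply => //.
  - move=> y; rewrite in_itv /= => /andP[y1 _].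
    have := D y (lt_trans ltr01 y1); by case.
  - move=> y; rewrite in_itv /= => /andP[y1 _].
    have y0 := lt_trans ltr01 y1.
    rewrite derive1E (@derive_val _ _ _ _ _ _ _ (D y y0)).
    by rewrite divr_ge0 ?sqr_ge0 // exprn_ge0 // ltW.
  - apply: derivable_within_continuous => y; rewrite in_itv /= => /andP[y1 _].
    have := D y (lt_le_trans ltr01 y1); by case.
by rewrite /f ln1 invr1; lra.
Qed.

Lemma natr_ceilP x : 0 <= x -> x <= `|Num.ceil x|%N%:R < x + 1.
Proof.
move=> x0; have /andP[lt1 le1] := ceil_itv x.
have c0 : 0 <= Num.ceil x by rewrite -(@ler0z R); apply: le_trans le1.
have -> : `|Num.ceil x|%N%:R = (Num.ceil x)%:~R :> R by rewrite pmulrn gez0_abs.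
by move: lt1; rewrite le1 intrB /=; lra.
Qed.

Lemma ln_natr_ge1 n : (3 <= n)%N -> 1 <= ln n%:R :> R.
Proof.
move=> n3.
have l3 : 1 <= ln 3 :> R.
  (* ln 3 >= 6 ln (6/5) >= 6 (1 - 5/6) *)
  have l65 : 1 - (6 / 5 : R)^-1 <= ln (6 / 5).
    have x0 : 0 < (6 / 5)^-1 :> R by rewrite invr_gt0 divr_gt0.
    have /le_ln1Dx : -1 < (6 / 5)^-1 - 1 :> R by lra.
    by rewrite [1 + _]addrC subrK lnV ?posrE ?divr_gt0 //; lra.
  apply: (@le_trans _ _ (ln ((6 / 5) ^+ 6))).
    have e : (6 / 5)^-1 = 5 / 6 :> R by field.
    rewrite lnXn ?divr_gt0 // -[_ *+ 6]mulr_natl; by rewrite e in l65; lra.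
  rewrite ler_ln ?posrE ?exprn_gt0 ?divr_gt0 //.
  have e3 : (6 / 5) ^+ 3 = 216 / 125 :> R by field.
  by rewrite (exprM _ 3 2) e3 expr2; lra.
by apply: le_trans l3 _; rewrite ler_ln ?posrE ?ltr0n ?ler_nat //; exact: leq_trans n3.
Qed.

End Analysis.

Section NumDraws.
Variables (R : realType) (d : nat) (I : {fset 'rV[int]_d}) (c delta : R).
Hypotheses (I3 : (3 <= #|` I|)%N) (delta01 : 0 < delta < 1) (c1 : 1 < c).
Local Notation s J := (num_draws I c delta J).

Local Notation q := ((c / (c - 1)) ^+ 2).
Local Notation X J := (q * ((ln #|` J|%:R + ln #|` I|%:R - ln delta) / 2)).

Lemma oversampling_ge1 : 1 <= q.
Proof.
rewrite exprn_ege1 //.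
by rewrite ler_pdivlMr; have := c1; lra.
Qed.

Lemma ln_delta_lt0 : ln delta < 0.
Proof. by rewrite ln_lt0. Qed.

Lemma num_drawsP J : J != fset0 -> X J <= (s J)%:R < X J + 1.
Proof.
move=> J0; apply: natr_ceilP; rewrite mulr_ge0 //; first by have := oversampling_ge1; lra.
have : 0 <= ln #|` J|%:R :> R by rewrite ln_ge0 // ler1n cardfs_gt0.
by have := ln_delta_lt0; have := ln_natr_ge1 R I3; lra.
Qed.

(** Allows the potential to use the number of draws of the first pass throughout. Nonnegativity of
    the ceiling is needed because [num_draws] takes an absolute value. *)
Lemma num_draws_le J : J `<=` I -> J != fset0 -> (s J <= s I)%N.
Proof.
move=> JI J0; rewrite /num_draws.
have XJI : X J <= X I.
  rewrite ler_wpM2l //; first by have := oversampling_ge1; lra.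
  suff : ln #|` J|%:R <= ln #|` I|%:R :> R by lra.
  rewrite ler_ln ?posrE ?ltr0n ?cardfs_gt0 ?ler_nat ?fsubset_leq_card //.
  by rewrite -cardfs_gt0; lia.
have X0 : 0 <= X J.
  rewrite mulr_ge0 //; first by have := oversampling_ge1; lra.
  have : 0 <= ln #|` J|%:R :> R by rewrite ln_ge0 // ler1n cardfs_gt0.
  by have := ln_delta_lt0; have := ln_natr_ge1 R I3; lra.
have := le_ceil XJI.
have : 0 <= Num.ceil (X J).
  by rewrite -(@ler0z R); apply: le_trans X0 _; have /andP[] := ceil_itv (X J).
by lia.
Qed.

(** After taking logarithms, the factor [(c / (c - 1)) ^+ 2 / 2] in the number of draws cancels the
    lower bound [2 * (1 - c^-1) ^+ 2] for [ln c]. *)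
Lemma expr_num_draws_le J : J != fset0 ->
  (c^-1) ^+ (s J) <= delta / (#|` J|%:R * #|` I|%:R).
Proof.
move=> J0; have /andP[leX _] := num_drawsP J0.
have T0 : 0 < #|` J|%:R :> R by rewrite ltr0n cardfs_gt0.
have T10 : 0 < #|` I|%:R :> R by rewrite ltr0n; lia.
have d0 : 0 < delta by case/andP: delta01.
have c0 : 0 < c by apply: lt_trans c1.
rewrite -ler_ln ?posrE ?exprn_gt0 ?invr_gt0 ?divr_gt0 ?mulr_gt0 //.
rewrite lnXn ?invr_gt0 ?lnV ?posrE ?ln_div ?posrE ?mulr_gt0 ?lnM ?posrE //.
set L := ln #|` J|%:R + ln #|` I|%:R - ln delta in leX *.
have L0 : 0 <= L.
  have : 0 <= ln #|` J|%:R :> R by rewrite ln_ge0 // ler1n cardfs_gt0.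
  by have := ln_delta_lt0; have := ln_natr_ge1 R I3; rewrite /L; lra.
suff : L <= (s J)%:R * ln c by rewrite -mulr_natl /L; lra.
have := ln_ge_sqr (ltW c1) => lec.
apply: (@le_trans _ _ (X J * (2 * (1 - c^-1) ^+ 2))).
  suff e l : q * (l / 2) * (2 * (1 - c^-1) ^+ 2) = l by rewrite e.
  by field; rewrite subr_eq0 !gt_eqF.
by apply: ler_pM => //; [rewrite mulr_ge0 ?divr_ge0 //; have := oversampling_ge1; lra
  |rewrite mulr_ge0 ?sqr_ge0].
Qed.

End NumDraws.

(** * Runs with covering passes *)

Lemma leq_card_bigfcup (K T : choiceType) (s : seq T) (U : T -> {fset K}) :
  (#|` \bigcup_(v <- s) U v| <= \sum_(v <- s) #|` U v|)%N.
Proof.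
elim: s => [|v s IH]; first by rewrite !big_nil cardfs0.
rewrite !big_cons; apply: leq_trans (leq_add (leqnn _) IH).
by have := cardfsUI (U v) (\bigcup_(v <- s) U v); lia.
Qed.

Lemma past_recr d (T : Type) (draws : nat -> T -> seq 'rV[int]_d) pick n w :
  past draws pick n.+1 w = rcons (past draws pick n w) (draws n w, pick n w).
Proof. by rewrite /past -[n.+1]addn1 iotaD map_cat cats1. Qed.

Section CoveringRun.
Variables (R : realType) (d : nat) (I : {fset 'rV[int]_d}) (c delta : R).
Hypotheses (I3 : (3 <= #|` I|)%N) (delta01 : 0 < delta < 1) (c1 : 1 < c).
Implicit Types (J : {fset 'rV[int]_d}) (vs : seq 'rV[int]_d).

Definition covering J vs : bool :=
  all (fun k => has (fun v => k \in unaliased J (modulus c J) v) vs) (enum_fset J).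

Local Notation s := (num_draws I c delta I).
Local Notation N := ((expansion I)%:~R : R).

(** The summand 1 next to the logarithm pays the share [2 * N] of the pass that empties [J]; after
    it nothing is left to pay, hence the value 0. *)
Definition potential (T : nat) : R :=
  if T == 0%N then 0 else 2 * c * s%:R * T%:R + 2 * N * (s%:R * ln T%:R + 1).

(** As [U >= T / s], the linear term drops by [2 c s U >= 2 c T]. From [ln (1 - U/T) <= - U/T], the
    quantity [s ln T] drops by at least [s U / T >= 1], which pays [2 * N]. *)
Lemma potential_step T U (M : R) : (0 < U <= T)%N -> (T <= s * U)%N ->
  M <= 2 * (c * T%:R + N) -> M + potential (T - U) <= potential T.
Proof.
move=> /andP[U0 UT] TsU leM.
have N0 : 0 <= N by rewrite ler0z expansion_ge0.
have s1 : 1 <= s%:R :> R.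
  by rewrite ler1n; case: (num_draws _ _ _ _) TsU => //; rewrite mul0n; lia.
have UR : 1 <= U%:R :> R by rewrite ler1n.
have UTR : U%:R <= T%:R :> R by rewrite ler_nat.
have TsUR : T%:R <= s%:R * U%:R :> R by rewrite -natrM ler_nat.
have cT : c * T%:R <= c * (s%:R * U%:R) by rewrite ler_pM2l //; have := c1; lra.
have lnT : 0 <= s%:R * ln T%:R :> R by rewrite mulr_ge0 ?ln_ge0 //; lra.
have T0 : (T == 0%N) = false by rewrite gtn_eqF // (leq_trans U0).
rewrite /potential T0; case: ifPn => [/eqP TU0|TU0].
  have eTU : U%:R = T%:R :> R by congr _%:R; apply/eqP; rewrite eqn_leq UT -subn_eq0 TU0.
  have := mulr_ge0 N0 lnT; rewrite eTU in cT; lra.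
have TU : (T - U)%:R = T%:R - U%:R :> R by rewrite natrB.
have TUp : 0 < T%:R - U%:R :> R by rewrite -TU ltr0n lt0n.
have Tp : 0 < T%:R :> R by lra.
have lnTU : s%:R * ln (T - U)%:R + 1 <= s%:R * ln T%:R :> R.
  have e : (T - U)%:R = T%:R * (1 + - (U%:R / T%:R)) :> R.
    by rewrite TU mulrDr mulr1 mulrN mulrC divfK // gt_eqF.
  have xp : 0 < 1 + - (U%:R / T%:R) :> R.
    by rewrite -(@pmulr_rgt0 _ T%:R) // -e TU.
  have lnx : ln (1 + - (U%:R / T%:R)) <= - (U%:R / T%:R) :> R.
    by apply: le_ln1Dx; lra.
  rewrite e lnM ?posrE // mulrDr.
  have : s%:R * ln (1 + - (U%:R / T%:R)) <= s%:R * (- (U%:R / T%:R)) :> R.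
    by rewrite ler_pM2l //; lra.
  have : 1 <= s%:R * (U%:R / T%:R) :> R by rewrite mulrA ler_pdivlMr // mul1r.
  lra.
have : N * (s%:R * ln (T - U)%:R + 1) <= N * (s%:R * ln T%:R) by rewrite ler_wpM2l.
rewrite TU; lra.
Qed.

Lemma card_le_covering J vs m : covering J vs ->
  (forall v, v \in vs -> (#|` unaliased J (modulus c J) v| <= m)%N) ->
  (#|` J| <= size vs * m)%N.
Proof.
move=> /allP cov lem.
apply: (@leq_trans #|` \bigcup_(v <- vs) unaliased J (modulus c J) v|).
  apply/fsubset_leq_card/fsubsetP => k kJ; have /hasP[v vvs ku] := cov k kJ.
  by apply/bigfcupP; exists v; rewrite ?vvs.
apply: leq_trans (leq_card_bigfcup _ _) _.
rewrite -sum1_size big_distrl /= big_seq [leqRHS]big_seq.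
by apply: leq_sum => v vvs; rewrite mul1n lem.
Qed.

Lemma remaining_rcons_max h vs i0 (J := remaining I c h) (M := modulus c J)
    (U := unaliased J M (nth 0 vs i0)) :
  J != fset0 -> (i0 < size vs)%N -> (0 < #|` U|)%N ->
  remaining I c (rcons h (vs, i0)) = J `\` U /\
  output I c (rcons h (vs, i0)) = rcons (output I c h) (nth 0 vs i0, M).
Proof.
rewrite /U /M /J /remaining /output /state foldl_rcons -/(state I c h).
case: (state I c h) => J' out /= /negPf-> lti U0.
rewrite ifT //; apply: leq_trans U0 _.
exact: (@leq_bigmax_seq _ vs xpredT (fun v => #|` unaliased J' (modulus c J') v|) _ (mem_nth 0 lti)).
Qed.

Lemma sum_moduli_step h vs i0 (J := remaining I c h) :
  J != fset0 -> size vs = num_draws I c delta J -> (i0 < size vs)%N ->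
  (forall v, v \in vs -> (#|` unaliased J (modulus c J) v|
     <= #|` unaliased J (modulus c J) (nth 0%R vs i0)|)%N) ->
  covering J vs ->
  (#|` remaining I c (rcons h (vs, i0))| < #|` J|)%N /\
  \sum_(p <- output I c (rcons h (vs, i0))) p.2%:R
      + potential #|` remaining I c (rcons h (vs, i0))|
    <= \sum_(p <- output I c h) p.2%:R + potential #|` J|.
Proof.
move=> J0 szvs lti maxi cov.
have JI : J `<=` I := remaining_sub I c h.
have leJ := card_le_covering cov maxi.
set U := unaliased _ _ _ in leJ maxi.
have U0 : (0 < #|` U|)%N.
  by rewrite lt0n; apply/negP => /eqP U0; move: leJ; rewrite U0 muln0 leqNgt cardfs_gt0 J0.
have UJ : U `<=` J by apply/fsubsetP => k; rewrite inE => /andP[].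
have [-> ->] := remaining_rcons_max J0 lti U0.
rewrite cardfsD (fsetIidPr UJ) -/J.
have leUJ := fsubset_leq_card UJ.
split; first by lia.
rewrite -cats1 big_cat big_seq1 /= -addrA lerD2l.
apply: potential_step; first by rewrite U0.
  apply: leq_trans leJ _; rewrite leq_mul2r szvs.
  by rewrite (num_draws_le I3 delta01 c1 JI J0) orbT.
exact: modulus_le.
Qed.

(** A covering pass removes at least one frequency, so [#|I|] passes suffice, and an empty [J]
    freezes the state. The induction carries along that the moduli spent plus the remaining
    potential never exceed the initial potential. *)
Lemma covering_run (Omega : Type) (draws : nat -> Omega -> seq 'rV[int]_d)
    (pick : nat -> Omega -> nat) (w : Omega) :
  (forall n (J := remaining I c (past draws pick n w)), (n < #|` I|)%N -> J != fset0 ->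
    [/\ size (draws n w) = num_draws I c delta J, (pick n w < size (draws n w))%N,
     (forall v, v \in draws n w -> (#|` unaliased J (modulus c J) v|
       <= #|` unaliased J (modulus c J) (nth 0%R (draws n w) (pick n w))|)%N) &
     covering J (draws n w)]) ->
  let h := past draws pick #|` I| w in
  remaining I c h = fset0 /\
  \sum_(p <- output I c h) p.2%:R <= potential #|` I|.
Proof.
move=> good /=.
suff H n : (n <= #|` I|)%N -> let h := past draws pick n w in
    (#|` remaining I c h| <= #|` I| - n)%N /\
    \sum_(p <- output I c h) p.2%:R + potential #|` remaining I c h| <= potential #|` I|.
  have [] := H _ (leqnn _); rewrite subnn leqn0 => /eqP c0.
  by rewrite c0 /potential eqxx addr0; split=> //; exact: cardfs0_eq.
elim: n => [_|n IH ltn] /=; first by rewrite subn0 big_nil add0r.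
have [IH1 IH2] := IH (ltnW ltn).
rewrite past_recr; set h := past _ _ n w in IH1 IH2 *.
have [J0|J0] := eqVneq (remaining I c h) fset0.
  have [e1 e2] : remaining I c (rcons h (draws n w, pick n w)) = remaining I c h /\
                 output I c (rcons h (draws n w, pick n w)) = output I c h.
    move: J0; rewrite /remaining /output /state foldl_rcons -/(state I c h).
    by case: (state I c h) => J' out /= ->; rewrite eqxx.
  by rewrite e1 e2; split=> //; rewrite J0 cardfs0.
have [szvs lti maxi cov] := good n ltn J0.
have [lt1 le2] := sum_moduli_step J0 szvs lti maxi cov.
split; last exact: le_trans le2 IH2.
by rewrite subnS -ltnS prednK ?subn_gt0 //; exact: leq_trans lt1 IH1.
Qed.

(** The assumption gives [N ln T <= c (T - 1)], so the terms with [s] add up to less than [4 c s T].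
    Rounding up in [s] costs [4 c T], and [2 N <= 2 c (T - 1)] by [ln T >= 1]; together they make
    the constant 6, and the leftover [- 2 c] absorbs the 1. *)
Lemma potential_le : N <= c * (#|` I|%:R - 1) / ln (#|` I|%:R : R) ->
  1 + potential #|` I| <=
  (2 * (c / (c - 1)) ^+ 2 * (2 * ln #|` I|%:R - ln delta) + 6) * c * #|` I|%:R.
Proof.
have I0 : I != fset0 by rewrite -cardfs_gt0; lia.
have l1 := ln_natr_ge1 R I3.
have /andP[_ lts] := num_drawsP I3 delta01 c1 I0.
have s0 : 0 <= s%:R :> R by [].
have T3 : 3 <= #|` I|%:R :> R by rewrite (ler_nat _ 3).
have N0 : 0 <= N by rewrite ler0z expansion_ge0.
rewrite ler_pdivlMr; last by lra.
rewrite /potential ifN; last by rewrite cardfs_eq0.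
set T := #|` I|%:R in l1 lts T3 *; set L := ln T in l1 lts *.
set q := (c / (c - 1)) ^+ 2 in lts *.
move: N0 s0 lts; move: N s%:R => x y x0 y0 lts NL.
have h1 : y * (x * L) <= y * (c * (T - 1)) by rewrite ler_wpM2l.
have h2 : x <= c * (T - 1).
  by apply: le_trans NL; rewrite -[leLHS]mulr1 ler_wpM2l.
have cT : 0 < c * T by rewrite mulr_gt0 //; have := c1; lra.
have h3 : y * (c * T) <= (q * ((L + L - ln delta) / 2) + 1) * (c * T).
  by rewrite ler_pM2r // ltW.
have h4 : 0 <= c * y by rewrite mulr_ge0 //; have := c1; lra.
have := c1; lra.
Qed.

End CoveringRun.

(** * Failure probability *)

Section CountableConditioning.
Variables (R : realType) (disp : measure_display) (Omega : measurableType disp).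
Variables (P : probability Omega R) (T : countType) (X : Omega -> T).
Hypothesis mX : forall t, measurable [set w | X w = t]%classic.

Lemma measurable_countable_preimage (Q : set T) :
  measurable [set w | Q (X w)]%classic.
Proof.
pose F (i : nat) : set Omega :=
  if @choice.pickle_inv T i is Some t then [set w | X w = t /\ Q t]%classic else set0.
have -> : [set w | Q (X w)]%classic = (\bigcup_i F i)%classic.
  apply/seteqP; split => [w /= Qw|w [i _]].
    by exists (choice.pickle (X w)) => //; rewrite /F pickleK_inv.
  by rewrite /F; case: (@choice.pickle_inv T i) => //= t [-> ].
apply: bigcupT_measurable => i; rewrite /F; case: (@choice.pickle_inv T i) => // t.
have [Qt|nQt] := pselect (Q t).
  have -> : [set w | X w = t /\ Q t]%classic = [set w | X w = t]%classic.
    by apply/seteqP; split => w /= // [].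
  exact: mX.
have -> : [set w | X w = t /\ Q t]%classic = set0 by apply/seteqP; split => w // [].
exact: measurable0.
Qed.

Lemma probability_le_conditional (E : set Omega) (e : R) : 0 <= e ->
  measurable E ->
  (forall t, (P ([set w | X w = t] `&` E) <= e%:E * P [set w | X w = t])%E%classic) ->
  (P E <= e%:E)%E.
Proof.
move=> e0 mE le_cond.
pose G (i : nat) : set Omega :=
  if @choice.pickle_inv T i is Some t then [set w | X w = t]%classic else set0.
have mG i : measurable (G i) by rewrite /G; case: (@choice.pickle_inv T i).
have GT : (\bigcup_i G i)%classic = setT.
  apply/seteqP; split => // w _; exists (choice.pickle (X w)) => //.
  by rewrite /G pickleK_inv.
have tG : trivIset setT G.
  move=> i j _ _ [w []]; rewrite /G.
  have := @pickle_invK T i; case: (@choice.pickle_inv T i) => //= t <- <-.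
  by have := @pickle_invK T j; case: (@choice.pickle_inv T j) => //= t' <- <-.
have GE i : (P (G i `&` E) <= e%:E * P (G i))%E%classic.
  by rewrite /G; case: (@choice.pickle_inv T i) => [t|]; rewrite ?set0I ?measure0 ?mule0.
have mGE i : measurable (G i `&` E)%classic by apply: measurableI.
have -> : E = (\bigcup_i (G i `&` E))%classic by rewrite -setI_bigcupl GT setTI.
have tGE : trivIset setT (fun i => G i `&` E)%classic by exact: trivIset_setIr.
rewrite measure_semi_bigcup //; last exact: bigcupT_measurable.
apply: (@le_trans _ _ (\sum_(0 <= i <oo) (e%:E * P (G i)))%E).
  by apply: lee_nneseries => [i _ _|i _]; [exact: measure_ge0|exact: GE].
rewrite nneseriesZl // -measure_semi_bigcup //; last exact: bigcupT_measurable.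
by have := probability_setT P; rewrite GT /= => ->; rewrite mule1.
Qed.

End CountableConditioning.

Lemma measure_le_sum_cover (R : realType) (disp : measure_display)
    (Omega : measurableType disp) (P : probability Omega R) (T : choiceType) (s : seq T)
    (A : set Omega) (B : T -> set Omega) :
  measurable A -> (forall t, measurable (B t)) ->
  (forall w, A w -> exists2 t, t \in s & B t w) ->
  (P A <= \sum_(t <- s) P (B t))%E.
Proof.
move=> mA mB AB.
have mU (s' : seq T) : measurable (\big[setU/set0]_(t <- s') B t).
  by apply: bigsetU_measurable.
apply: (@le_trans _ _ (P (\big[setU/set0]_(t <- s) B t))).
  apply: le_measure; rewrite ?inE // => w /AB[t ts Bt].
  by rewrite -bigcup_seq; exists t.
elim: (s) => [|t s' IH]; first by rewrite !big_nil measure0.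
rewrite !big_cons; apply: (le_trans (measureU2 _ (mB t) (mU s'))).
exact: leeD2l.
Qed.

Section PassFailure.
Variables (R : realType) (d : nat) (I : {fset 'rV[int]_d}) (c delta : R).
Hypotheses (I3 : (3 <= #|` I|)%N) (delta01 : 0 < delta < 1) (c1 : 1 < c).
Variables (disp : measure_display) (Omega : measurableType disp).
Variables (P : probability Omega R) (draws : nat -> Omega -> seq 'rV[int]_d).
Variables (pick : nat -> Omega -> nat).
Hypothesis S : construction_S I c delta P draws pick.

Local Open Scope classical_set_scope.

Definition failing_pass n : set Omega :=
  [set w | remaining I c (past draws pick n w) != fset0 /\
           ~~ covering c (remaining I c (past draws pick n w)) (draws n w)].

Lemma measurable_past n h : measurable [set w | past draws pick n w = h].
Proof.
elim: n h => [|n IH] h.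
  have [->|h0] := eqVneq h [::].
    by rewrite (_ : [set _ | _] = setT) //; apply/seteqP; split.
  rewrite (_ : [set _ | _] = set0) //; apply/seteqP; split => // w /= e.
  by rewrite -e in h0.
case/lastP: h => [|h [vs i]].
  by rewrite (_ : [set _ | _] = set0) //; apply/seteqP; split.
have -> : [set w | past draws pick n.+1 w = rcons h (vs, i)] =
    [set w | past draws pick n w = h] `&`
      ([set w | draws n w = vs] `&` [set w | pick n w = i]).
  apply/seteqP; split => w; rewrite /setI /mkset past_recr.
    by move=> /rcons_inj[-> -> ->].
  by move=> [-> [-> ->]].
apply: measurableI => //; apply: measurableI.
  exact: (measurable_draws S).
exact: (measurable_pick S).
Qed.

Lemma measurable_failing_pass n : measurable (failing_pass n).
Proof.
(* The past of length [n + 1] has the draws of pass [n] as part of its last entry, so failure is a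
   property of a variable with countably many values. *)
pose Q (h : seq (pass d)) := exists h' p, h = rcons h' p /\
  (remaining I c h' != fset0 /\ ~~ covering c (remaining I c h') p.1).
have := @measurable_countable_preimage _ Omega _ _ (measurable_past n.+1) Q.
congr measurable; apply/seteqP; split => w; rewrite /Q /failing_pass /mkset.
  by rewrite past_recr => -[h' [p [/rcons_inj[<- <-]]]].
by move=> bad; exists (past draws pick n w), (draws n w, pick n w); rewrite past_recr.
Qed.

Lemma failing_pass_conditional n h :
  (P ([set w | past draws pick n w = h] `&` failing_pass n)
     <= (delta / #|` I|%:R)%:E * P [set w | past draws pick n w = h])%E.
Proof.
have e0 : 0 <= delta / #|` I|%:R by rewrite divr_ge0 // ltW //; case/andP: delta01.
set J := remaining I c h; set A := [set w | past draws pick n w = h].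
have mA : measurable A := measurable_past n h.
have [J0|J0] := eqVneq J fset0.
  rewrite (_ : _ `&` _ = set0) ?measure0 ?mule_ge0 //.
  by apply/seteqP; split => // w [/= ew []]; rewrite ew -/J J0 eqxx.
set s := num_draws I c delta J; set M := modulus c J.
have pM : prime M := modulus_prime c J.
pose al k := [set u : 'rV['F_M]_d | k \notin unaliased J M (int_row u)]%SET.
pose vs (f : {ffun 'I_s -> 'rV['F_M]_d}) := [seq int_row (f i) | i <- enum 'I_s].
pose B f := [set w | A w /\ draws n w = vs f].
have mB f : measurable (B f).
  have -> : B f = A `&` [set w | draws n w = vs f] by [].
  by apply: measurableI => //; exact: (measurable_draws S).
have PB f : P (B f) = (((M ^ d)%:R^-1 ^+ s)%:E * P A)%E.
  have := @draws_law _ _ _ _ _ _ _ _ _ _ S n h (vs f) J0.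
  rewrite size_map size_enum_ord => /(_ erefl) ->; rewrite muleC; congr (_%:E * _)%E.
  rewrite big_map big_enum /= (eq_bigr (fun=> (M ^ d)%:R^-1)) => [|i _].
    by rewrite prodr_const card_ord.
  by rewrite /unif_box int_row_in_box.
(* The event that all [s] draws alias [k], split into single tuples of draws because [draws_law]
   gives the probability of each tuple. *)
pose Bk k := \big[setU/set0]_(f <- enum (ffun_on (al k))) B f.
have mBk k : measurable (Bk k) by apply: bigsetU_measurable.
have cover w : (A `&` failing_pass n) w -> exists2 k, k \in enum_fset J & Bk k w.
  move=> [Aw [_]]; rewrite Aw -/J => /allPn[k kJ ncov].
  have J0w : remaining I c (past draws pick n w) != fset0 by rewrite Aw.
  have [] := draws_range S J0w; rewrite Aw -/J -/s -/M => szd box.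
  exists k => //; rewrite /Bk -bigcup_seq.
  have ex (i : 'I_s) : exists u : 'rV['F_M]_d, nth 0 (draws n w) i = int_row u.
    by apply: (in_box_int_row pM); apply: (allP box); rewrite mem_nth // szd.
  have [f fE] := fin_all_exists ex.
  have dE : draws n w = vs [ffun i => f i].
    apply: (@eq_from_nth _ 0); first by rewrite size_map size_enum_ord.
    move=> i; rewrite szd => lti; rewrite (nth_map (Ordinal lti)) ?size_enum_ord //.
    by rewrite ffunE -fE nth_enum_ord.
  exists [ffun i => f i]; last by split.
  rewrite /= mem_enum; apply/ffun_onP => i; rewrite ffunE inE -fE.
  by apply: (hasPn ncov); rewrite mem_nth // szd.
have mAF : measurable (A `&` failing_pass n).
  by apply: measurableI => //; exact: measurable_failing_pass.
apply: (le_trans (measure_le_sum_cover P mAF mBk cover)).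
have leBk k : k \in J -> (P (Bk k) <= (c^-1 ^+ s)%:E * P A)%E.
  move=> kJ.
  have Bk_cover w : Bk k w -> exists2 f, f \in enum (ffun_on (al k)) & B f w.
    by rewrite /Bk -bigcup_seq => -[f ? ?]; exists f.
  apply: (le_trans (measure_le_sum_cover P (mBk k) mB Bk_cover)).
  under eq_bigr do rewrite PB.
  rewrite -ge0_sume_distrl; last by move=> *; rewrite lee_fin exprn_ge0 ?invr_ge0.
  rewrite lee_wpmul2r // sumEFin lee_fin big_enum /= sumr_const card_ffun_on card_ord.
  (* The sum is the [s]-th power of the proportion of vectors aliasing [k], which is at most
     [(#|J| - 1) / M] and hence at most [1 / c]. *)
  rewrite -[_ *+ _]mulr_natl natrX -exprMn; apply: lerXn2r; rewrite ?nnegrE ?invr_ge0 ?mulr_ge0 //.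
    by rewrite ltW //; apply: lt_trans c1.
  have [inP ltM] := modulusP c J; rewrite -/M in inP ltM.
  have := aliased_card_le pM inP kJ; rewrite -/(al k) => leal.
  have M0 : 0 < M%:R :> R by rewrite ltr0n prime_gt0.
  have Md0 : 0 < (M ^ d)%:R :> R by rewrite ltr0n expn_gt0 prime_gt0.
  have c0 : 0 < c by apply: lt_trans c1.
  rewrite ler_pdivrMr // -(ler_pM2r M0) -natrM.
  apply: (@le_trans _ _ ((#|` J| - 1) * M ^ d)%:R); first by rewrite ler_nat.
  rewrite natrM mulrAC ler_pM2r // mulrC ler_pdivlMr // mulrC.
  by rewrite natrB ?cardfs_gt0 // ltW.
rewrite big_seq; apply: (@le_trans _ _ (\sum_(k <- enum_fset J | k \in enum_fset J) (c^-1 ^+ s)%:E * P A)%E).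
  by apply: lee_sum => k kJ; exact: leBk.
rewrite -big_seq -ge0_sume_distrl; last by move=> *; rewrite lee_fin exprn_ge0 // invr_ge0 ltW // (lt_trans _ c1).
rewrite lee_wpmul2r // sumEFin lee_fin big_const_seq count_predT iter_addr_0.
(* The factor [#|J|] from the union bound over [k] cancels the one in the denominator here. *)
have := expr_num_draws_le I3 delta01 c1 J0; rewrite -/s => les.
have T0 : 0 < #|` J|%:R :> R by rewrite ltr0n cardfs_gt0.
have I0 : 0 < #|` I|%:R :> R by rewrite ltr0n; apply: leq_trans I3.
apply: le_trans (ler_wMn2r #|` J| les) _.
rewrite -[_ *+ _]mulr_natr le_eqVlt; apply/orP; left; apply/eqP.
by field; rewrite !gt_eqF.
Qed.

Lemma probability_failing_pass n : (P (failing_pass n) <= (delta / #|` I|%:R)%:E)%E.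
Proof.
apply: (@probability_le_conditional _ _ _ _ _ _ (measurable_past n)).
- by rewrite divr_ge0 // ltW //; case/andP: delta01.
- exact: measurable_failing_pass.
- exact: failing_pass_conditional.
Qed.

End PassFailure.

(** * The success event and its complement *)

Theorem corollary4p2 (R : realType) (d : nat) (I : {fset 'rV[int]_d})
    (c delta : R)
    (disp : measure_display) (Omega : measurableType disp)
    (P : probability Omega R)
    (draws : nat -> Omega -> seq 'rV[int]_d) (pick : nat -> Omega -> nat) :
  (3 <= #|` I|)%N ->
  0 < delta < 1 ->
  1 < c ->
  (expansion I)%:~R <= c * (#|` I|%:R - 1) / ln (#|` I|%:R : R) ->
  construction_S I c delta P draws pick ->
  let success : set Omega := [set w | exists n : nat,
    let h := past draws pick n w in
    let zM := output I c h in
    let X : {fset 'rV[R]_d} := mrank1_lattice zM in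
    [/\ remaining I c h = fset0,
        reconstructing I X &
        (#|` X|%:R : R) <= 1 - (size zM)%:R + \sum_(p <- zM) p.2%:R
          <= (2 * (c / (c - 1)) ^+ 2 * (2 * ln #|` I|%:R - ln delta) + 6)
             * c * #|` I|%:R ]]%classic in
  measurable success /\ ((1 - delta)%:E <= P success)%E.
Proof.
move=> I3 delta01 c1 leN S success.
pose Q (h : seq (pass d)) : Prop :=
  let zM := output I c h in let X : {fset 'rV[R]_d} := mrank1_lattice zM in
  [/\ remaining I c h = fset0, reconstructing I X &
      (#|` X|%:R : R) <= 1 - (size zM)%:R + \sum_(p <- zM) p.2%:R
        <= (2 * (c / (c - 1)) ^+ 2 * (2 * ln #|` I|%:R - ln delta) + 6)
           * c * #|` I|%:R ].
have mS : measurable success.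
  have -> : success = (\bigcup_n [set w | Q (past draws pick n w)])%classic.
    by apply/seteqP; split => [w [n Qn]|w [n _ Qn]]; exists n.
  apply: bigcupT_measurable => n.
  exact: measurable_countable_preimage (measurable_past S n) Q.
split=> //.
have mC : measurable (~` success)%classic by apply: measurableC.
(* If none of the first [#|I|] passes fails, [n = #|I|] witnesses success; the union bound over
   these passes then costs [#|I|] times [delta / #|I|]. *)
have cover w : (~` success)%classic w ->
    exists2 n, n \in iota 0 #|` I| & failing_pass I c draws pick n w.
  move=> nsucc; apply: contrapT => nofail; apply: nsucc.
  exists #|` I|; set h := past draws pick #|` I| w => /=.
  have [|J0 sumM] := @covering_run _ _ _ _ _ I3 delta01 c1 _ draws pick w.
    move=> n J ltn J0; have [szd _] := draws_range S J0.
    have [lti maxi] := pick_max S J0; split=> //.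
    apply: contrapT => /negP ncov; apply: nofail.
    by exists n; rewrite ?mem_iota.
  have lpot := potential_le I3 delta01 c1 leN.
  have s0 : 0 <= (size (output I c h))%:R :> R by [].
  split=> //; first exact: reconstructing_output.
  apply/andP; split; last by move: sumM; rewrite -/h; lra.
  have := @card_mrank1_lattice R d (output I c h) (@output_modulus_gt0 _ _ _ _ h).
  by rewrite -(@ler_nat R) !natrD natr_sum; lra.
have PC : (P (~` success)%classic <= delta%:E)%E.
  apply: (le_trans (measure_le_sum_cover P mC (measurable_failing_pass S) cover)).
  have le_fail n : (P (failing_pass I c draws pick n) <= (delta / #|` I|%:R)%:E)%E.
    exact: probability_failing_pass.
  apply: (le_trans (lee_sum _ (fun n _ => le_fail n))).
  rewrite sumEFin lee_fin big_const_seq count_predT iter_addr_0 size_iota.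
  by rewrite -[_ *+ _]mulr_natr divfK // pnatr_eq0 -lt0n (leq_trans _ I3).
have finP : P success \is a fin_num by exact: fin_num_measure.
move: PC; rewrite probability_setC // -(fineK finP) -EFinB !lee_fin; lra.
Qed.
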